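(* Let $X$ be a finite quandle, $S\subset \mathrm{End}(X)$ a set of quandle endomorphisms of $X$, $R$ a commutative ring with identity, and $(t,s)$ a quandle module over $X$ with coefficients in $R$. Then the quandle module quiver polynomial $\Phi_{X,S}^{t,s}(L)$ is an invariant of oriented knots and links: if $D$ and $D'$ are two diagrams of the same oriented link $L$ (equivalently, if they are related by a finite sequence of oriented Reidemeister moves and planar isotopies), then $\Phi_{X,S}^{t,s}(D)=\Phi_{X,S}^{t,s}(D')$.
   Context: A quandle is a set $X$ with a binary operation $\triangleright$ such that (i) $x\triangleright x=x$ for all $x\in X$; (ii) for every $y\in X$ the map $f_y:X\to X$, $f_y(x)=x\triangleright y$, is invertible; (iii) $(x\triangleright y)\triangleright z=(x\triangleright z)\triangleright(y\triangleright z)$ for all $x,y,z\in X$. A quandle endomorphism is a map $f:X\to X$ with $f(x\triangleright y)=f(x)\triangleright f(y)$ for all $x,y\in X$; $\mathrm{End}(X)$ is the set of these. Colorings. Let $D$ be a diagram of an oriented (tame) link. Its arcs are the maximal pieces of the diagram running from undercrossing to undercrossing (a component that never passes under is a single closed arc). An $X$-coloring of $D$ is an assignment of elements of $X$ to the arcs such that at every crossing, if $y$ is the color of the overcrossing arc, $x$ the color of the undercrossing arc lying on the right of the oriented overcrossing strand, and $z$ the color of the undercrossing arc lying on its left, then $z=x\triangleright y$ (regardless of the orientation of the understrand). The set of $X$-colorings is denoted $\mathcal{C}(D,X)$. Quandle modules. Maps $t,s:X\times X\to R$, written $t_{x,y}$ and $s_{x,y}$, define a quandle module over $X$ with coefficients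 in $R$ if for all $x,y,z\in X$ the element $t_{x,y}$ is a unit of $R$ and $$t_{x,x}+s_{x,x}=1,$$ $$t_{x\triangleright y,z}\,t_{x,y}=t_{x\triangleright z,\,y\triangleright z}\,t_{x,z},$$ $$t_{x\triangleright y,z}\,s_{x,y}=s_{x\triangleright z,\,y\triangleright z}\,t_{y,z},$$ $$s_{x\triangleright y,z}=t_{x\triangleright z,\,y\triangleright z}\,s_{x,z}+s_{x\triangleright z,\,y\triangleright z}\,s_{y,z}.$$ Module matrix. Given an $X$-coloring $C$ of $D$, write $D_C$ for the colored diagram. Attach to each arc a variable (a ''bead'') with values in $R$. At each crossing, with arcs colored $x$ (right under-arc), $y$ (over-arc), $x\triangleright y$ (left under-arc) and carrying beads $a,b,c$ respectively, impose the linear equation $c=t_{x,y}a+s_{x,y}b$. The matrix $M_{t,s}(D_C)$ over $R$ is the coefficient matrix of this homogeneous linear system (one row per crossing, one column per arc), and $\mathrm{Ker}\,M_{t,s}(D_C)$ is its solution set, a submodule of $R^{\{\text{arcs of }D\}}$. Quiver. $\mathcal{Q}_{X,S}^{t,s}(D)$ is the directed multigraph having one vertex for each $C\in\mathcal{C}(D,X)$ and, for each vertex $C$ and each $f\in S$, one directed edge from $C$ to the coloring $f(C)$ obtained by applying $f$ to every color. The vertex $C$ is given the weight $w(C)=|\mathrm{Ker}\,M_{t,s}(D_C)|$ if $R$ is finite, and $w(C)=\mathrm{Rank}(\mathrm{Ker}\,M_{t,s}(D_C))$ if $R$ is infinite, where for an $R$-module $N$, $\mathrm{Rank}(N)$ is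 the number of generators of the free part of $N$, i.e. the largest $r$ such that $N\cong R^r\oplus T$ for some $R$-module $T$. Polynomial. The quandle module quiver polynomial is the two-variable polynomial in formal variables $\sigma,\tau$ $$\Phi_{X,S}^{t,s}(D)=\sum_{e}\sigma^{w(C_1(e))}\tau^{w(C_2(e))},$$ where the sum is over all edges $e$ of $\mathcal{Q}_{X,S}^{t,s}(D)$ and $e$ is directed from the vertex $C_1(e)$ to the vertex $C_2(e)$. *)

(* Defs.v *)
From HB Require Import structures.
From mathcomp Require Import all_boot all_order all_algebra finmap.
From mathcomp Require Import boolp classical_sets functions cardinality.
From Stdlib Require Import Relation_Operators.

Set Implicit Arguments.
Unset Strict Implicit.
Unset Printing Implicit Defensive.

Import GRing.Theory.
Local Open Scope ring_scope.

(** * Oriented link diagrams and Reidemeister moves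

  A diagram is cut into directed segments at its crossings and at bivalent
  marked points.  Marked points carry no topological information; they are there
  so that a closed curve without crossings has a segment, and so that a local
  picture containing an uncrossed strand can be written down.  A picture lists
  its crossings and its marked points, and names the segments meeting at each. *)

(* [positive]: the direction of the over strand followed by that of the under
   strand is a positively oriented basis of the plane. *)
Record crossing (E : Type) : Type := Crossing {
  positive : bool; overpass : E * E; underpass : E * E }. (* (incoming, outgoing) *)

Section CrossingEq.
Variable E : eqType.

Definition crossing_code (x : crossing E) := (positive x, overpass x, underpass x).
Definition crossing_decode (c : bool * (E * E) * (E * E)) :=
  Crossing c.1.1 c.1.2 c.2.
Lemma crossing_codeK : cancel crossing_code crossing_decode.
Proof. by case. Qed.

HB.instance Definition _ := Equality.copy (crossing E) (can_type crossing_codeK).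

End CrossingEq.

(* A marked point is the pair (incoming segment, outgoing segment). *)
Record picture (E : Type) : Type := Picture {
  crossings : seq (crossing E); marks : seq (E * E) }.

Section Picture.
Variable E : eqType.
Implicit Types p q : picture E.

Definition incoming p : seq E :=
  flatten [seq [:: (overpass x).1; (underpass x).1] | x <- crossings p]
  ++ unzip1 (marks p).
Definition outgoing p : seq E :=
  flatten [seq [:: (overpass x).2; (underpass x).2] | x <- crossings p]
  ++ unzip2 (marks p).

Definition picture_union p q : picture E :=
  Picture (crossings p ++ crossings q) (marks p ++ marks q).

Definition same_picture p q : bool :=
  perm_eq (crossings p) (crossings q) && perm_eq (marks p) (marks q).

(* The cyclic sequence, counterclockwise, of the segment ends at each vertex;
   [(e, true)] is the end where [e] leaves and [(e, false)] where it arrives. *)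
Definition crossing_ends (x : crossing E) : seq (E * bool) :=
  if positive x then [:: ((overpass x).2, true); ((underpass x).2, true);
                         ((overpass x).1, false); ((underpass x).1, false)]
  else [:: ((overpass x).2, true); ((underpass x).1, false);
           ((overpass x).1, false); ((underpass x).2, true)].
Definition mark_ends (m : E * E) : seq (E * bool) :=
  [:: (m.2, true); (m.1, false)].
Definition vertices p : seq (seq (E * bool)) :=
  map crossing_ends (crossings p) ++ map mark_ends (marks p).

(* Follow the segment to its other end, then turn to the next end there; the
   orbits are the boundary walks of the faces. *)
Definition face_step p (d : E * bool) : E * bool :=
  let d' := (d.1, ~~ d.2) in
  next (head [::] [seq v <- vertices p | d' \in v]) d'.

Definition adjacent p : rel E :=
  [rel e e' | has (fun v => (e \in unzip1 v) && (e' \in unzip1 v)) (vertices p)].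

End Picture.

Definition relabel (E F : Type) (f : E -> F) (p : picture E) : picture F :=
  let ff u := (f u.1, f u.2) in
  Picture [seq Crossing (positive x) (ff (overpass x)) (ff (underpass x)) | x <- crossings p]
          (map ff (marks p)).

(* Every segment leaves one vertex and arrives at one vertex. *)
Definition closed_picture (E : finType) (p : picture E) : bool :=
  perm_eq (incoming p) (enum E) && perm_eq (outgoing p) (enum E).

(* Euler's formula V - E + F = 2 C, i.e. every component has genus 0. *)
Definition planar (E : finType) (p : picture E) : Prop :=
  (size (vertices p) + fcard (face_step p) predT
     = #|E| + 2 * n_comp (adjacent p) predT)%N.

Record diagram : Type := Diagram {
  segment : finType;
  diagram_picture :> picture segment;
  diagram_closed : closed_picture diagram_picture;
  diagram_planar : planar diagram_picture }.

(* [mark_segment e e' p] puts a marked point on [e], whose second half is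
   renamed [e']. *)
Definition mark_segment (E : eqType) (e e' : E) (p : picture E) : picture E :=
  let r u := if u == e then e' else u in
  Picture [seq Crossing (positive x) (r (overpass x).1, (overpass x).2)
                        (r (underpass x).1, (underpass x).2) | x <- crossings p]
          ((e, e') :: [seq (r m.1, m.2) | m <- marks p]).

(* Three strands, the top one running over the middle one running over the
   bottom one, that bound a triangle.  [pt]: the top strand meets the middle one
   before the bottom one; [pm]: the middle strand meets the bottom one before the
   top one; [pb]: the bottom strand meets the top one before the middle one.
   Counterclockwise, the sides of the triangle are top, middle, bottom if [c], and
   top, bottom, middle otherwise.  As the strands are straight in the plane, [c]
   and the three orders determine the signs. *)
Definition triangle (E : Type) (c pt pm pb : bool) (t m b : E * E * E) : picture E :=
  let part (first : bool) (l : E * E * E) :=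
    if first then l.1 else (l.1.2, l.2) in
  Picture
    [:: Crossing (c (+) pt (+) pm) (part pt t) (part (~~ pm) m);
        Crossing (c (+) pm (+) pb) (part pm m) (part (~~ pb) b);
        Crossing (~~ (c (+) pt (+) pb)) (part (~~ pt) t) (part pb b)] [::].

(* All oriented versions; a move replaces the first local picture by the second
   inside a diagram, or conversely. *)
Inductive reidemeister (E : Type) : picture E -> picture E -> Prop :=
| Reidemeister1_over_first (s : bool) (a m b : E) :
    reidemeister (Picture [::] [:: (a, b)])
                 (Picture [:: Crossing s (a, m) (m, b)] [::])
| Reidemeister1_under_first (s : bool) (a m b : E) :
    reidemeister (Picture [::] [:: (a, b)])
                 (Picture [:: Crossing s (m, b) (a, m)] [::])
| Reidemeister2_parallel (s : bool) (a m b c n d : E) :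
    reidemeister (Picture [::] [:: (a, b); (c, d)])
                 (Picture [:: Crossing s (a, m) (c, n);
                              Crossing (~~ s) (m, b) (n, d)] [::])
| Reidemeister2_antiparallel (s : bool) (a m b c n d : E) :
    reidemeister (Picture [::] [:: (a, b); (c, d)])
                 (Picture [:: Crossing s (a, m) (n, d);
                              Crossing (~~ s) (m, b) (c, n)] [::])
| Reidemeister3 (c pt pm pb : bool) (t m b : E * E * E) :
    reidemeister (triangle c pt pm pb t m b)
                 (triangle c (~~ pt) (~~ pm) (~~ pb) t m b).

(* [move_same] and [move_mark], with [diagram_move], express planar isotopy. *)
Inductive move (E : eqType) (p q : picture E) : Prop :=
| move_same : same_picture p q -> move p q
| move_mark (e e' : E) :
    e \in incoming p -> same_picture q (mark_segment e e' p) -> move p q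
| move_reidemeister (l l' r : picture E) :
    reidemeister l l' ->
    same_picture p (picture_union l r) -> same_picture q (picture_union l' r) -> move p q.

(* The segment names of a diagram are immaterial; names outside the images of [i]
   and [j] do not occur, so the inner segments of a move are automatically new. *)
Definition diagram_move (D D' : diagram) : Prop :=
  exists (i : segment D -> nat) (j : segment D' -> nat),
    [/\ injective i, injective j & move (relabel i D) (relabel j D')].

Definition same_link : diagram -> diagram -> Prop :=
  clos_refl_sym_trans diagram diagram_move.

(** * Arcs *)

Definition right_under (E : Type) (x : crossing E) : E :=
  if positive x then (underpass x).1 else (underpass x).2.
Definition left_under (E : Type) (x : crossing E) : E :=
  if positive x then (underpass x).2 else (underpass x).1.

Section Arcs.
Variable D : diagram.

(* A strand continues through marked points and when it runs over. *)
Definition continues : rel (segment D) :=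
  [rel e e' | ((e, e') \in marks D) || ((e, e') \in map (@overpass _) (crossings D))].

Definition arc_set (e : segment D) : {set segment D} :=
  [set e' | connect [rel u v | continues u v || continues v u] e e'].

Definition link_arc : finType := {A : {set segment D} | A \in [set arc_set e | e : segment D]}.

Definition arc_of (e : segment D) : link_arc := exist _ (arc_set e) (imset_f arc_set isT).

End Arcs.

(** * Quandles and colorings *)

Record finQuandle : Type := FinQuandle {
  quandle_sort :> finType;
  qop : quandle_sort -> quandle_sort -> quandle_sort;
  qop_id : forall x, qop x x = x;
  qop_bij : forall y, bijective (fun x => qop x y);
  qop_dist : forall x y z, qop (qop x y) z = qop (qop x z) (qop y z) }.

Section Coloring.
Variable X : finQuandle.

Definition is_endo (f : {ffun X -> X}) : bool :=
  [forall x, forall y, f (qop x y) == qop (f x) (f y)].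

Definition endo : finType := {f : {ffun X -> X} | is_endo f}.

Variable D : diagram.

Definition is_coloring (C : {ffun link_arc D -> X}) : bool :=
  all (fun x => C (arc_of (left_under x))
                == qop (C (arc_of (right_under x))) (C (arc_of (overpass x).1)))
      (crossings D).

Definition coloring : finType := {C : {ffun link_arc D -> X} | is_coloring C}.

Lemma endo_coloring (f : endo) (C : coloring) :
  is_coloring [ffun a => val f (val C a)].
Proof.
apply/allP => x xD; rewrite !ffunE (eqP (allP (valP C) x xD)).
by have /forallP /(_ _) /forallP := valP f; apply.
Qed.

Definition apply_endo (f : endo) (C : coloring) : coloring :=
  exist _ [ffun a => val f (val C a)] (endo_coloring f C).

End Coloring.

(** * Quandle modules *)

Section QuandleModule.
Variables (X : finQuandle) (R : comPzRingType) (t s : X -> X -> R).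

Record quandle_module : Prop := QuandleModule {
  qmod_unit : forall x y, exists u, t x y * u = 1;
  qmod_id : forall x, t x x + s x x = 1;
  qmod_tt : forall x y z,
    t (qop x y) z * t x y = t (qop x z) (qop y z) * t x z;
  qmod_ts : forall x y z,
    t (qop x y) z * s x y = s (qop x z) (qop y z) * t y z;
  qmod_ss : forall x y z,
    s (qop x y) z = t (qop x z) (qop y z) * s x z + s (qop x z) (qop y z) * s y z }.

Variables (D : diagram) (C : coloring X D).

(* Row [i] encodes t a + s b - c = 0 at the [i]-th crossing; coefficients add up
   when arcs coincide. *)
Definition module_matrix : 'M[R]_(size (crossings D), #|link_arc D|) :=
  \matrix_(i, j)
    let k := tnth (in_tuple (crossings D)) i in
    let a := arc_of (right_under k) in
    let b := arc_of (overpass k).1 in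
    let c := arc_of (left_under k) in
    let x := val C a in let y := val C b in
    t x y *+ (enum_val j == a) + s x y *+ (enum_val j == b) - 1 *+ (enum_val j == c).

Definition module_kernel : set 'cV[R]_#|link_arc D| :=
  [set v | module_matrix *m v = 0]%classic.

End QuandleModule.

(* The submodule [N] of [V] is isomorphic to R^r (+) T for some module T. *)
Definition has_free_part (R : comPzRingType) (V : lmodType R) (N : set V) (r : nat) : Prop :=
  exists (T : lmodType R) (f : {linear ('rV[R]_r * T)%type -> V}),
    injective f /\ range f = N.

Definition free_rank (R : comPzRingType) (V : lmodType R) (N : set V) : nat :=
  xget 0%N [set r | has_free_part N r
                    /\ forall r', has_free_part N r' -> (r' <= r)%N]%classic.

Definition module_weight (R : comPzRingType) (V : lmodType R) (N : set V) : nat :=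
  if pselect (finite_set [set: R]%classic) then #|` fset_set N| else free_rank N.

(** * Quivers *)

Record weighted_quiver : Type := WeightedQuiver {
  vertex : finType;
  edge : finType;
  source : edge -> vertex;
  target : edge -> vertex;
  weight : vertex -> nat }.

Definition module_quiver (X : finQuandle) (S : {set endo X}) (R : comPzRingType)
    (t s : X -> X -> R) (D : diagram) : weighted_quiver :=
  @WeightedQuiver (coloring X D) (coloring X D * {f : endo X | f \in S})%type
    (fun e => e.1) (fun e => apply_endo (val e.2) e.1)
    (fun C => module_weight (module_kernel t s C)).

(* The polynomial ring Z[sigma][tau]. *)
Definition sigma : {poly {poly int}} := 'X%:P.
Definition tau : {poly {poly int}} := 'X.

Definition quiver_polynomial (Q : weighted_quiver) : {poly {poly int}} :=
  \sum_(e : edge Q) sigma ^+ weight (source e) * tau ^+ weight (target e).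

Definition module_quiver_polynomial (X : finQuandle) (S : {set endo X})
    (R : comPzRingType) (t s : X -> X -> R) (D : diagram) : {poly {poly int}} :=
  quiver_polynomial (module_quiver S t s D).

(* Main.v *)
(* A pair (color, bead) at each segment that solves the crossing equations of C
   and of M_{t,s}(D_C) is exactly a coloring by the quandle X * R with operation
   (x, a) |> (y, b) = (x |> y, t_{x,y} a + s_{x,y} b); the module axioms say that
   this is a quandle.  So everything follows from the classical fact that a
   Reidemeister move induces, for every quandle, a bijection between the colorings
   of the two diagrams, in the form: there is a relation between the segments,
   independent of the quandle, such that each coloring of one diagram agrees along
   it with exactly one coloring of the other.  Agreement is compatible with
   quandle morphisms, hence with endomorphisms and with the projection X * R -> X,
   and it is linear in the beads; so it gives isomorphic quivers and isomorphic
   kernels. *)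
From HB Require Import structures.
From mathcomp Require Import all_boot all_order all_algebra finmap.
From mathcomp Require Import boolp classical_sets functions cardinality.
From mathcomp Require Import zify.
Require Import Defs.

Set Implicit Arguments.
Unset Strict Implicit.
Unset Printing Implicit Defensive.

Import GRing.Theory.
Local Open Scope ring_scope.

(** * Quandle labellings of pictures *)

Record is_quandle (Y : Type) (op : Y -> Y -> Y) : Prop := IsQuandle {
  op_id : forall x, op x x = x;
  op_inv : exists inv : Y -> Y -> Y, forall y,
    cancel (op^~ y) (inv^~ y) /\ cancel (inv^~ y) (op^~ y);
  op_dist : forall x y z, op (op x y) z = op (op x z) (op y z) }.

(** Label after passing under a strand labelled [y] at a crossing of sign [s]: a negative crossing
    undoes the action of [y]. *)
Definition signed_op (Y : Type) (op inv : Y -> Y -> Y) (s : bool) (x y : Y) : Y :=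
  if s then op x y else inv x y.

Section SignedOp.
Variables (Y : Type) (op inv : Y -> Y -> Y).
Hypothesis opQ : is_quandle op.
Hypothesis invK : forall y, cancel (op^~ y) (inv^~ y) /\ cancel (inv^~ y) (op^~ y).
Local Notation act := (signed_op op inv).

Lemma signed_opK s x y : act s (act (~~ s) x y) y = x.
Proof. by case: s; rewrite /signed_op; case: (invK y) => H1 H2; [apply: H2|apply: H1]. Qed.

Lemma signed_opNK s x y : act (~~ s) (act s x y) y = x.
Proof. by rewrite -{2}[s]negbK signed_opK. Qed.

Lemma signed_op_id s x : act s x x = x.
Proof.
case: s; rewrite /signed_op; first exact: op_id opQ x.
by rewrite -{1}(op_id opQ x); case: (invK x) => + _; apply.
Qed.

Lemma signed_op_inj s y : injective (act s ^~ y).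
Proof. by apply: (can_inj (g := act (~~ s) ^~ y)) => x; exact: signed_opNK. Qed.

(** Acting by [z] is an automorphism of [op], hence respects the inverse action too; the inverse of
    an automorphism is again one. *)
Lemma signed_op_dist s s' x y z :
  act s (act s' x y) z = act s' (act s x z) (act s y z).
Proof.
have D s1 x1 y1 z1 : act true (act s1 x1 y1) z1 = act s1 (act true x1 z1) (act true y1 z1).
  case: s1; first exact: op_dist.
  apply: (@signed_op_inj true (act true y1 z1)) => /=.
  rewrite -(op_dist opQ) [RHS](signed_opK true); congr op; exact: (signed_opK true).
case: s => //; apply: (@signed_op_inj true z).
have K u v : act true (act false u v) v = u by exact: (signed_opK true).
by rewrite [RHS]D !K.
Qed.

End SignedOp.

Section Labelling.
Variables (E : eqType) (Y : Type) (op : Y -> Y -> Y).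
Implicit Types (p q : picture E) (c : E -> Y).

(** Labels sit on segments rather than arcs, so constancy along the over strand is a condition of
    its own. *)
Definition crossing_ok c (x : crossing E) : Prop :=
  c (overpass x).1 = c (overpass x).2
  /\ c (left_under x) = op (c (right_under x)) (c (overpass x).1).

Definition labelling p c : Prop :=
  {in crossings p, forall x, crossing_ok c x}
  /\ {in marks p, forall m, c m.1 = c m.2}.

(** Since the action is invertible, the relation between right and left can be read along the
    understrand instead; outgoing labels then become functions of incoming ones. *)
Lemma signed_crossing_ok inv c x :
    (forall y, cancel (op^~ y) (inv^~ y) /\ cancel (inv^~ y) (op^~ y)) ->
  crossing_ok c x <-> c (overpass x).2 = c (overpass x).1
    /\ c (underpass x).2
       = signed_op op inv (positive x) (c (underpass x).1) (c (overpass x).1).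
Proof.
move=> invK; rewrite /crossing_ok /left_under /right_under /signed_op.
case: x => [[]] [o1 o2] [u1 u2] /=.
  by split=> -[<- ->].
have [K1 K2] := invK (c o1).
by split=> [[<- ->]|[-> ->]]; split=> //; rewrite ?K1 ?K2.
Qed.

Lemma labelling_union p q c :
  labelling (picture_union p q) c <-> labelling p c /\ labelling q c.
Proof.
split=> [[cr mk]|[[cr mk] [cr' mk']]].
  by split; split=> x xp; [apply: cr|apply: mk|apply: cr|apply: mk];
     rewrite mem_cat xp ?orbT.
by split=> x; rewrite mem_cat => /orP[]; [apply: cr|apply: cr'|apply: mk|apply: mk'].
Qed.

Lemma labelling_same p q c : same_picture p q -> labelling p c -> labelling q c.
Proof.
move=> /andP[/perm_mem pq /perm_mem pq'] [cr mk].
by split=> x xq; [apply: cr; rewrite pq|apply: mk; rewrite pq'].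
Qed.

Lemma mem_incoming p x : x \in crossings p ->
  (overpass x).1 \in incoming p /\ (underpass x).1 \in incoming p.
Proof.
move=> xp; rewrite !mem_cat; split; apply/orP; left; apply/flatten_mapP; exists x => //;
by rewrite !inE eqxx ?orbT.
Qed.

Lemma mem_outgoing p x : x \in crossings p ->
  (overpass x).2 \in outgoing p /\ (underpass x).2 \in outgoing p.
Proof.
move=> xp; rewrite !mem_cat; split; apply/orP; left; apply/flatten_mapP; exists x => //;
by rewrite !inE eqxx ?orbT.
Qed.

Lemma mem_marks p m : m \in marks p -> m.1 \in incoming p /\ m.2 \in outgoing p.
Proof. by move=> mp; rewrite !mem_cat !map_f ?orbT. Qed.

Lemma eq_labelling p c d :
    {in incoming p, c =1 d} -> {in outgoing p, c =1 d} ->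
  labelling p c -> labelling p d.
Proof.
move=> ci co [cr mk]; split=> x xp.
  have [i1 i2] := mem_incoming xp; have [o1 o2] := mem_outgoing xp.
  have := cr x xp; rewrite /crossing_ok /left_under /right_under.
  by case: (positive x); rewrite (ci _ i1) (ci _ i2) (co _ o1) (co _ o2).
by have [i1 i2] := mem_marks xp; rewrite -ci // -co // mk.
Qed.

End Labelling.

Lemma labelling_relabel (E F : eqType) (Y : Type) (op : Y -> Y -> Y)
    (f : E -> F) (p : picture E) (c : F -> Y) :
  labelling op (relabel f p) c <-> labelling op p (c \o f).
Proof.
rewrite /labelling /relabel /=; split=> -[cr mk]; split.
- move=> x xp; have := cr _ (map_f _ xp).
  by rewrite /crossing_ok /left_under /right_under /=; case: (positive x).
- by move=> m mp; have := mk _ (map_f _ mp).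
- move=> _ /mapP[x xp ->]; have := cr x xp.
  by rewrite /crossing_ok /left_under /right_under /=; case: (positive x).
- by move=> _ /mapP[x xp ->]; exact: mk.
Qed.

(** * Incidence lists of closed pictures *)

Section Incidence.
Variable E : eqType.
Implicit Types p q : picture E.

(** Closedness without reference to a finite type of all names, so that it applies to pictures named
    in [nat]. *)
Definition closed_labels p : Prop :=
  [/\ uniq (incoming p), uniq (outgoing p) & incoming p =i outgoing p].

Lemma perm_incoming_union p q :
  perm_eq (incoming (picture_union p q)) (incoming p ++ incoming q).
Proof.
by rewrite /incoming map_cat flatten_cat /unzip1 map_cat -!catA perm_cat2l perm_catCA.
Qed.

Lemma perm_outgoing_union p q :
  perm_eq (outgoing (picture_union p q)) (outgoing p ++ outgoing q).
Proof.
by rewrite /outgoing map_cat flatten_cat /unzip2 map_cat -!catA perm_cat2l perm_catCA.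
Qed.

Lemma perm_incoming p q : same_picture p q -> perm_eq (incoming p) (incoming q).
Proof.
by move=> /andP[pq pq']; rewrite perm_cat ?perm_map // perm_flatten ?perm_map.
Qed.

Lemma perm_outgoing p q : same_picture p q -> perm_eq (outgoing p) (outgoing q).
Proof.
by move=> /andP[pq pq']; rewrite perm_cat ?perm_map // perm_flatten ?perm_map.
Qed.

Lemma closed_labels_same p q : same_picture p q -> closed_labels p -> closed_labels q.
Proof.
move=> pq; have ii := perm_incoming pq; have oo := perm_outgoing pq.
rewrite /closed_labels (perm_uniq ii) (perm_uniq oo) => -[-> -> H]; split=> // u.
by rewrite -(perm_mem ii) -(perm_mem oo).
Qed.

Lemma same_pictureC p q : same_picture p q -> same_picture q p.
Proof. by move=> /andP[pq pq']; rewrite /same_picture perm_sym pq perm_sym. Qed.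

End Incidence.

(** * Reidemeister moves *)

(* [n] and [n'] list the inner segments of the local pictures; Reidemeister 3 uses
   the same inner names on both sides with different labels, so these must be
   excluded explicitly from the comparison. *)
Record local_transfer (E : eqType) (l l' : picture E) (n n' : seq E) : Prop :=
  LocalTransfer {
    inner_incoming : {subset n <= incoming l};
    inner_outgoing : {subset n <= outgoing l};
    outer_incoming : forall u, u \in incoming l -> u \notin n ->
      (u \in incoming l') && (u \notin n');
    local_extension : forall (Y : Type) (op : Y -> Y -> Y) (c : E -> Y),
      is_quandle op -> labelling op l c ->
      exists2 c', labelling op l' c' & forall u, u \notin n' -> c' u = c u;
    local_determined : forall (Y : Type) (op : Y -> Y -> Y) (c c' : E -> Y),
      is_quandle op -> labelling op l c -> labelling op l c' ->
      (forall u, (u \in incoming l) || (u \in outgoing l) -> u \notin n ->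
         c u = c' u) -> {in n, c =1 c'} }.

(* [K] must not depend on the quandle: this is what makes the correspondence of
   labellings compatible with quandle morphisms. *)
Record transfer (E : eqType) (p q : picture E) (K : pred E) : Prop := Transfer {
    tie_incoming : {subset K <= incoming p};
    extension : forall (Y : Type) (op : Y -> Y -> Y) (c : E -> Y),
      is_quandle op -> labelling op p c ->
      exists2 c', labelling op q c' & {in K, c' =1 c};
    determined : forall (Y : Type) (op : Y -> Y -> Y) (c c' : E -> Y),
      is_quandle op -> labelling op p c -> labelling op p c' ->
      {in K, c =1 c'} -> {in incoming p, c =1 c'} }.

(** The inner segments of [l'] do not meet [r], because the incidence lists of [q] have no
    repetition; so relabelling them keeps the labelling of [r] valid. Conversely, the tied segments
    are all the outer ones of [p], and these determine the inner ones. *)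
Lemma local_transfer_union (E : eqType) (p q l l' r : picture E) (n n' : seq E) :
    closed_labels p -> closed_labels q ->
    same_picture p (picture_union l r) -> same_picture q (picture_union l' r) ->
    local_transfer l l' n n' -> {subset n' <= incoming l'} -> {subset n' <= outgoing l'} ->
  transfer p q [pred u | [&& u \in incoming p, u \in incoming q, u \notin n & u \notin n']].
Proof.
move=> [ip op_ iop] [iq oq ioq] pE qE [ni no oi ext det] n'i n'o.
have mip u : (u \in incoming p) = (u \in incoming l) || (u \in incoming r).
  by rewrite (perm_mem (perm_incoming pE)) (perm_mem (perm_incoming_union l r)) mem_cat.
have mop u : (u \in outgoing p) = (u \in outgoing l) || (u \in outgoing r).
  by rewrite (perm_mem (perm_outgoing pE)) (perm_mem (perm_outgoing_union l r)) mem_cat.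
have miq u : (u \in incoming q) = (u \in incoming l') || (u \in incoming r).
  by rewrite (perm_mem (perm_incoming qE)) (perm_mem (perm_incoming_union l' r)) mem_cat.
have rn' u : u \in n' -> (u \notin incoming r) /\ (u \notin outgoing r).
  move=> un'; split.
    move: iq; rewrite (perm_uniq (perm_incoming qE)) (perm_uniq (perm_incoming_union _ _)).
    by rewrite cat_uniq => /and3P[_ /hasPn H _]; apply/negP => /H; rewrite /= n'i.
  move: oq; rewrite (perm_uniq (perm_outgoing qE)) (perm_uniq (perm_outgoing_union _ _)).
  by rewrite cat_uniq => /and3P[_ /hasPn H _]; apply/negP => /H; rewrite /= n'o.
split=> [u /and4P[]//|Y op c opQ /(labelling_same pE)/labelling_union[lc rc]|].
  have [c' lc' cc'] := ext _ _ _ opQ lc.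
  exists c'; last by move=> u /and4P[_ _ _]; exact: cc'.
  apply: labelling_same (same_pictureC qE) _; apply/labelling_union; split=> //.
  apply: eq_labelling rc => u ur; rewrite cc' //.
    by apply: contraTN ur => /rn'[].
  by apply: contraTN ur => /rn'[].
move=> Y op c c' opQ /(labelling_same pE)/labelling_union[lc _].
move=> /(labelling_same pE)/labelling_union[lc' _] cc'.
have out u : u \in incoming p -> u \notin n -> c u = c' u.
  move=> up un; apply: cc'; rewrite !inE up un miq /=.
  move: up; rewrite mip => /orP[/oi/(_ un)/andP[-> ->]//|ur].
  by rewrite ur orbT; apply: contraTN ur => /rn'[].
move=> u up; have [un|] := boolP (u \in n); last exact: out.
apply: (det _ _ _ _ opQ lc lc') => // v vl; apply: out.
move: vl => /orP[vl|vl]; first by rewrite mip vl.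
(* An outgoing segment of [l] is also incoming somewhere in [p], as [p] is closed. *)
by rewrite iop mop vl.
Qed.

Lemma labelling_nil (E : eqType) (Y : Type) (op : Y -> Y -> Y) (c : E -> Y) ms :
  labelling op (Picture [::] ms) c <-> {in ms, forall m, c m.1 = c m.2}.
Proof. by split=> [[]|]//; split. Qed.

Lemma labelling_cons (E : eqType) (Y : Type) (op : Y -> Y -> Y) (c : E -> Y) x xs ms :
  labelling op (Picture (x :: xs) ms) c
  <-> crossing_ok op c x /\ labelling op (Picture xs ms) c.
Proof.
split=> [[/= /forall_cons[xok cr] mk]|[xok [cr mk]]]; first by split; last split.
by split=> //=; apply/forall_cons.
Qed.

(** * Solving the crossing equations of each local picture *)

Section Reidemeister.
Variable E : eqType.
Implicit Types (a b m n u v : E).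

(* The two constructors for Reidemeister 1; [reid2] does the same for Reidemeister 2. *)
Definition reid1 (over_first s : bool) a m b : picture E :=
  Picture [:: if over_first then Crossing s (a, m) (m, b)
              else Crossing s (m, b) (a, m)] [::].

Lemma labelling_reid1 (Y : Type) (op : Y -> Y -> Y) f s a m b c :
    is_quandle op ->
  labelling op (reid1 f s a m b) c <-> c m = c a /\ c a = c b.
Proof.
move=> opQ; have [inv invK] := op_inv opQ.
rewrite labelling_cons (signed_crossing_ok _ _ invK) labelling_nil.
case: f => /=; split.
- by move=> [[-> ->] _]; rewrite (signed_op_id opQ invK).
- by move=> [-> <-]; split=> //; rewrite (signed_op_id opQ invK).
(* When the strand first passes under, the label of the loop acts on [c a]; as it also fixes itself,
   injectivity of the action gives equality. *)
- move=> [[bm ma] _]; suff am : c m = c a by rewrite bm am.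
  apply: (signed_op_inj invK (s := s) (y := c m)).
  by rewrite -ma (signed_op_id opQ invK).
- by move=> [-> <-]; split=> //; rewrite (signed_op_id opQ invK).
Qed.

Lemma perm_incoming_reid1 f s a m b :
  perm_eq (incoming (reid1 f s a m b)) [:: a; m].
Proof. by case: f; apply/permP => P /=; lia. Qed.

Lemma perm_outgoing_reid1 f s a m b :
  perm_eq (outgoing (reid1 f s a m b)) [:: m; b].
Proof. by case: f; apply/permP => P /=; lia. Qed.

Lemma reid1_transfer f s a m b :
    uniq (incoming (reid1 f s a m b)) -> uniq (outgoing (reid1 f s a m b)) ->
  local_transfer (Picture [::] [:: (a, b)]) (reid1 f s a m b) [::] [:: m]
  /\ local_transfer (reid1 f s a m b) (Picture [::] [:: (a, b)]) [:: m] [::].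
Proof.
have ip := perm_incoming_reid1 f s a m b.
have op_ := perm_outgoing_reid1 f s a m b.
rewrite (perm_uniq ip) (perm_uniq op_) /= !inE !andbT => am mb.
split; split=> //.
- move=> u; rewrite (perm_mem ip) /incoming /= !inE => /eqP -> _.
  by rewrite eqxx am.
- move=> Y op c opQ /labelling_nil/(_ _ (mem_head _ _)) /= ab.
  exists [eta c with m |-> c a] => [|u]; last by rewrite inE /= => /negPf->.
  apply/(labelling_reid1 _ _ _ _ _ _ opQ) => /=.
  by rewrite eqxx [b == m]eq_sym (negPf am) (negPf mb).
- by move=> u; rewrite (perm_mem ip) !inE => ->; rewrite orbT.
- by move=> u; rewrite (perm_mem op_) !inE => ->.
- by move=> u; rewrite (perm_mem ip) /incoming /= !inE => /orP[] ->.
- move=> Y op c opQ /(labelling_reid1 _ _ _ _ _ _ opQ)[_ ab]; exists c => //.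
  by apply/labelling_nil => x; rewrite inE => /eqP ->.
- move=> Y op c c' opQ /(labelling_reid1 _ _ _ _ _ _ opQ)[cm _].
  move=> /(labelling_reid1 _ _ _ _ _ _ opQ)[cm' _] cc' u; rewrite inE => /eqP ->.
  by rewrite cm cm' cc' ?(perm_mem ip) ?inE ?eqxx.
Qed.

Definition reid2 (par s : bool) a m b u n v : picture E :=
  Picture [:: Crossing s (a, m) (if par then (u, n) else (n, v));
              Crossing (~~ s) (m, b) (if par then (n, v) else (u, n))] [::].

(** The understrand goes from [u] through [n] to [v]. It first meets the crossing of sign [s] if the
    strands are parallel and the one of sign [~~ s] otherwise, whence [s == par]; the other crossing
    undoes the action. *)
Lemma labelling_reid2 (Y : Type) (op inv : Y -> Y -> Y) par s a m b u n v c :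
    (forall y, cancel (op^~ y) (inv^~ y) /\ cancel (inv^~ y) (op^~ y)) ->
  labelling op (reid2 par s a m b u n v) c <->
  [/\ c m = c a, c n = signed_op op inv (s == par) (c u) (c a), c a = c b & c u = c v].
Proof.
move=> invK; rewrite !labelling_cons !(signed_crossing_ok _ _ invK) labelling_nil.
case: par => /=; rewrite ?eqb_id ?eqbF_neg; split.
- by move=> [[-> ->] [[-> ->] _]]; rewrite (signed_opNK invK).
- by move=> [-> -> <- <-]; rewrite (signed_opNK invK).
- by move=> [[-> ->] [[-> ->] _]]; rewrite (signed_opK invK).
- by move=> [-> -> <- <-]; rewrite (signed_opK invK).
Qed.

Lemma perm_incoming_reid2 par s a m b u n v :
  perm_eq (incoming (reid2 par s a m b u n v)) [:: a; m; u; n].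
Proof. by case: par; apply/permP => P /=; lia. Qed.

Lemma perm_outgoing_reid2 par s a m b u n v :
  perm_eq (outgoing (reid2 par s a m b u n v)) [:: m; b; n; v].
Proof. by case: par; apply/permP => P /=; lia. Qed.

Lemma reid2_transfer par s a m b u n v :
    uniq (incoming (reid2 par s a m b u n v)) ->
    uniq (outgoing (reid2 par s a m b u n v)) ->
  local_transfer (Picture [::] [:: (a, b); (u, v)]) (reid2 par s a m b u n v)
    [::] [:: m; n]
  /\ local_transfer (reid2 par s a m b u n v) (Picture [::] [:: (a, b); (u, v)])
    [:: m; n] [::].
Proof.
have ip := perm_incoming_reid2 par s a m b u n v.
have op_ := perm_outgoing_reid2 par s a m b u n v.
rewrite (perm_uniq ip) (perm_uniq op_) /= !inE !negb_or !andbT.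
move=> /and3P[/and3P[am _ an] /andP[mu mn] un] /and3P[/and3P[mb _ mv] /andP[bn _] nv].
split; split=> //.
- move=> x; rewrite (perm_mem ip) /incoming /= !inE => /orP[] /eqP -> _.
    by rewrite eqxx (negPf am) (negPf an).
  by rewrite eqxx [u == m]eq_sym (negPf mu) (negPf un) !orbT.
- move=> Y op c opQ /labelling_nil/forall_cons[/= ab /forall_cons[/= uv _]].
  have [inv invK] := op_inv opQ.
  exists [eta c with m |-> c a, n |-> signed_op op inv (s == par) (c u) (c a)].
    apply/(labelling_reid2 _ _ _ _ _ _ _ _ _ invK) => /=; rewrite !eqxx.
    rewrite [b == m]eq_sym [u == m]eq_sym [v == m]eq_sym [n == m]eq_sym [v == n]eq_sym.
    by rewrite (negPf am) (negPf an) (negPf mu) (negPf mn) (negPf un) (negPf mb)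
      (negPf mv) (negPf bn) (negPf nv).
  by move=> x; rewrite !inE negb_or /= => /andP[/negPf-> /negPf->].
- by move=> x; rewrite (perm_mem ip) !inE => /orP[] ->; rewrite ?orbT.
- by move=> x; rewrite (perm_mem op_) !inE => /orP[] ->; rewrite ?orbT.
- move=> x; rewrite (perm_mem ip) /incoming /= !inE negb_or andbT.
  by case/or4P=> ->; rewrite ?orbT ?andbF.
- move=> Y op c opQ; have [inv invK] := op_inv opQ.
  move=> /(labelling_reid2 _ _ _ _ _ _ _ _ _ invK)[_ _ ab uv]; exists c => //.
  by apply/labelling_nil => x; rewrite !inE => /orP[] /eqP ->.
- move=> Y op c c' opQ; have [inv invK] := op_inv opQ.
  move=> /(labelling_reid2 _ _ _ _ _ _ _ _ _ invK)[cm cn _ _].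
  move=> /(labelling_reid2 _ _ _ _ _ _ _ _ _ invK)[cm' cn' _ _] cc'.
  have ca : c a = c' a.
    by rewrite cc' ?(perm_mem ip) ?inE ?eqxx // (negPf am) (negPf an).
  have cu : c u = c' u.
    rewrite cc' ?(perm_mem ip) ?inE ?eqxx ?orbT //.
    by rewrite [u == m]eq_sym (negPf mu) (negPf un).
  by move=> x; rewrite !inE => /orP[] /eqP ->; rewrite ?cm ?cm' ?cn ?cn' ca ?cu.
Qed.

Implicit Types (t mid bot : E * E * E).

(* Here and in [triangle_inner] the local variables [T] and [M] are the label of
   the top strand and the label of the middle strand where it runs over the bottom
   one; only [M] is affected by the move. *)
Definition triangle_outer (Y : Type) (op inv : Y -> Y -> Y) (s pt pm pb : bool)
    t mid bot (c : E -> Y) : Prop :=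
  let act := signed_op op inv in
  let T := c t.1.1 in let M := c (if pm then mid.1.1 else mid.2) in
  let tb := ~~ (s (+) pt (+) pb) in let mb := s (+) pm (+) pb in
  [/\ c t.2 = T, c mid.2 = act (s (+) pt (+) pm) (c mid.1.1) T
    & c bot.2 = if pb then act mb (act tb (c bot.1.1) T) M
              else act tb (act mb (c bot.1.1) M) T].

Definition triangle_inner (Y : Type) (op inv : Y -> Y -> Y) (s pt pm pb : bool)
    t mid bot (c : E -> Y) : Prop :=
  let act := signed_op op inv in
  let T := c t.1.1 in let M := c (if pm then mid.1.1 else mid.2) in
  [/\ c t.1.2 = T, c mid.1.2 = M
    & c bot.1.2 = if pb then act (~~ (s (+) pt (+) pb)) (c bot.1.1) T
                else act (s (+) pm (+) pb) (c bot.1.1) M].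

(** Each crossing fixes the labels of its two outgoing segments; substituting along the strands
    yields the inner labels and leaves three conditions on the outer ones. *)
Lemma labelling_triangle (Y : Type) (op inv : Y -> Y -> Y) s pt pm pb t mid bot c :
    (forall y, cancel (op^~ y) (inv^~ y) /\ cancel (inv^~ y) (op^~ y)) ->
  labelling op (triangle s pt pm pb t mid bot) c <->
  triangle_outer op inv s pt pm pb t mid bot c /\ triangle_inner op inv s pt pm pb t mid bot c.
Proof.
move=> invK; rewrite !labelling_cons !(signed_crossing_ok _ _ invK) labelling_nil.
rewrite /triangle_outer /triangle_inner.
case: t mid bot => [[t1 t2] t3] [[m1 m2] m3] [[b1 b2] b3].
case: pt; case: pm; case: pb => /=; split.
all: by [move=> [[-> ->] [[-> ->] [[-> ->] _]]]|move=> [[-> -> ->] [-> -> ->]]].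
Qed.

(** This is self-distributivity: acting by [M] and then by [T] equals acting by [T] and then by the
    image of [M] under [T], for all choices of signs. *)
Lemma triangle_outer_flip (Y : Type) (op inv : Y -> Y -> Y) s pt pm pb t mid bot c :
    is_quandle op ->
    (forall y, cancel (op^~ y) (inv^~ y) /\ cancel (inv^~ y) (op^~ y)) ->
  triangle_outer op inv s pt pm pb t mid bot c ->
  triangle_outer op inv s (~~ pt) (~~ pm) (~~ pb) t mid bot c.
Proof.
move=> opQ invK; rewrite /triangle_outer.
(* Each sign involves two of the three flipped bits, so the crossings keep their signs. *)
have -> : s (+) ~~ pt (+) ~~ pm = s (+) pt (+) pm by case: s pt pm => [] [] [].
have -> : s (+) ~~ pt (+) ~~ pb = s (+) pt (+) pb by case: s pt pb => [] [] [].
have -> : s (+) ~~ pm (+) ~~ pb = s (+) pm (+) pb by case: s pm pb => [] [] [].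
move=> [-> mE ->]; split=> //; case: pb => /=.
  (* It remains to relate the middle labels before and after the top strand by the action of the
     crossing of top and bottom; the sign rule of [triangle] makes its sign fit for both values of
     [pm]. *)
  rewrite [RHS](signed_op_dist opQ invK); congr signed_op.
  by case: pm mE => /= ->; rewrite !(addbT, addbF) ?negbK ?(signed_opK invK).
rewrite [LHS](signed_op_dist opQ invK); congr signed_op.
by case: pm mE => /= ->; rewrite !(addbT, addbF) ?(signed_opNK invK).
Qed.

Lemma perm_incoming_triangle s pt pm pb t mid bot :
  perm_eq (incoming (triangle s pt pm pb t mid bot))
    [:: t.1.1; t.1.2; mid.1.1; mid.1.2; bot.1.1; bot.1.2].
Proof.
case: t mid bot => [[t1 t2] t3] [[m1 m2] m3] [[b1 b2] b3].
by case: pt; case: pm; case: pb; apply/permP => P /=; lia.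
Qed.

Lemma perm_outgoing_triangle s pt pm pb t mid bot :
  perm_eq (outgoing (triangle s pt pm pb t mid bot))
    [:: t.1.2; t.2; mid.1.2; mid.2; bot.1.2; bot.2].
Proof.
case: t mid bot => [[t1 t2] t3] [[m1 m2] m3] [[b1 b2] b3].
by case: pt; case: pm; case: pb; apply/permP => P /=; lia.
Qed.

Lemma triangle_transfer s pt pm pb t mid bot :
    uniq (incoming (triangle s pt pm pb t mid bot)) ->
    uniq (outgoing (triangle s pt pm pb t mid bot)) ->
  let inner := [:: t.1.2; mid.1.2; bot.1.2] in
  local_transfer (triangle s pt pm pb t mid bot)
    (triangle s (~~ pt) (~~ pm) (~~ pb) t mid bot) inner inner.
Proof.
have ip := perm_incoming_triangle s pt pm pb t mid bot.
have op_ := perm_outgoing_triangle s pt pm pb t mid bot.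
have ip' := perm_incoming_triangle s (~~ pt) (~~ pm) (~~ pb) t mid bot.
rewrite (perm_uniq ip) (perm_uniq op_) => iu ou inner.
have [it im ib] : [/\ t.1.1 \notin inner, mid.1.1 \notin inner & bot.1.1 \notin inner].
  move: iu; rewrite /inner /= !inE !negb_or !andbT.
  case/and5P=> /and5P[-> _ -> _ ->] /and4P[n1 n2 n3 n4] /and3P[-> _ ->] /andP[n5 n6] ->.
  by rewrite ![_ == t.1.2]eq_sym [_ == mid.1.2]eq_sym n1 n3 n5.
have [ot om ob] : [/\ t.2 \notin inner, mid.2 \notin inner & bot.2 \notin inner].
  move: ou; rewrite /inner /= !inE !negb_or !andbT.
  case/and5P=> /and5P[n1 n2 n3 n4 n5] /and4P[-> _ -> _] /and3P[n6 n7 n8] /andP[-> _] n9.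
  by rewrite ![_ == t.1.2]eq_sym ![_ == mid.1.2]eq_sym ![_ == bot.1.2]eq_sym n1 n3 n5 n6 n8 n9.
split.
- by move=> u; rewrite (perm_mem ip) !inE => /or3P[] ->; rewrite ?orbT.
- by move=> u; rewrite (perm_mem op_) !inE => /or3P[] ->; rewrite ?orbT.
- by move=> u; rewrite (perm_mem ip) (perm_mem ip') => ->.
- move=> Y op c opQ; have [inv invK] := op_inv opQ.
  move=> /(labelling_triangle _ _ _ _ _ _ _ _ invK)[/(triangle_outer_flip opQ invK) out _].
  (* [T], [M] and [B] are the inner labels that [triangle_inner] demands of the flipped triangle. *)
  pose T := c t.1.1; pose M := c (if ~~ pm then mid.1.1 else mid.2).
  pose B := if ~~ pb then signed_op op inv (~~ (s (+) ~~ pt (+) ~~ pb)) (c bot.1.1) T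
            else signed_op op inv (s (+) ~~ pm (+) ~~ pb) (c bot.1.1) M.
  pose c' := [eta c with t.1.2 |-> T, mid.1.2 |-> M, bot.1.2 |-> B].
  have cc' u : u \notin inner -> c' u = c u.
    by rewrite !inE !negb_or /= => /and3P[/negPf-> /negPf-> /negPf->].
  have [tm tb mb] : [/\ t.1.2 != mid.1.2, t.1.2 != bot.1.2 & mid.1.2 != bot.1.2].
    move: iu; rewrite /= !inE !negb_or !andbT.
    by case/and5P=> _ /and4P[_ -> _ ->] _ /andP[_ ->].
  exists c' => //; apply/(labelling_triangle _ _ _ _ _ _ _ _ invK).
  have cM : c' (if ~~ pm then mid.1.1 else mid.2) = M by rewrite cc' //; case: (pm).
  split; first by rewrite /triangle_outer cM !cc'.
  rewrite /triangle_inner cM (cc' _ it) (cc' _ ib) /= !eqxx.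
  rewrite [mid.1.2 == _]eq_sym ![bot.1.2 == _]eq_sym.
  by rewrite (negPf tm) (negPf tb) (negPf mb).
- move=> Y op c c' opQ; have [inv invK] := op_inv opQ.
  move=> /(labelling_triangle _ _ _ _ _ _ _ _ invK)[_ [ct cm cb]].
  move=> /(labelling_triangle _ _ _ _ _ _ _ _ invK)[_ [ct' cm' cb']] cc'.
  have cT : c t.1.1 = c' t.1.1 by apply: cc'; rewrite // (perm_mem ip) mem_head.
  have cB : c bot.1.1 = c' bot.1.1.
    by apply: cc'; rewrite // (perm_mem ip) !inE eqxx !orbT.
  have cM : c (if pm then mid.1.1 else mid.2) = c' (if pm then mid.1.1 else mid.2).
    apply: cc'; last by case: (pm).
    by case: (pm); rewrite ?(perm_mem ip) ?(perm_mem op_) !inE eqxx !orbT.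
  by move=> u; rewrite !inE => /or3P[] /eqP ->; rewrite ?ct ?ct' ?cm ?cm' ?cb ?cb' ?cT ?cM ?cB.
Qed.

End Reidemeister.

Lemma reidemeister_transfer (E : eqType) (l l' : picture E) :
    reidemeister l l' ->
    uniq (incoming l) -> uniq (outgoing l) ->
    uniq (incoming l') -> uniq (outgoing l') ->
  exists n n', local_transfer l l' n n' /\ local_transfer l' l n' n.
Proof.
case=> [s a m b|s a m b|s a m b u n v|s a m b u n v|s pt pm pb t mid bot] iu ou iu' ou'.
- by exists [::], [:: m]; exact: (@reid1_transfer _ true).
- by exists [::], [:: m]; exact: (@reid1_transfer _ false).
- by exists [::], [:: m; n]; exact: (@reid2_transfer _ true).
- by exists [::], [:: m; n]; exact: (@reid2_transfer _ false).
exists [:: t.1.2; mid.1.2; bot.1.2], [:: t.1.2; mid.1.2; bot.1.2].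
split; first exact: triangle_transfer.
(* Flipping the three orders twice restores the triangle, so the converse is the same lemma. *)
by have := triangle_transfer iu' ou'; rewrite !negbK.
Qed.

(** * Transfer of labellings along a single move *)

Section Moves.
Variable E : eqType.
Implicit Types p q : picture E.

Lemma same_transfer p q : same_picture p q -> transfer p q [in incoming p].
Proof.
move=> pq; split=> // Y op c opQ pc; exists c => //.
exact: labelling_same pq pc.
Qed.

Lemma perm_incoming_mark e e' p :
  perm_eq (incoming (mark_segment e e' p))
    (e :: [seq if u == e then e' else u | u <- incoming p]).
Proof.
rewrite /incoming /mark_segment /= map_cat map_flatten -!map_comp -cat1s perm_catCA /=.
rewrite -cat1s perm_cat2l /unzip1 -map_comp.
by rewrite (@eq_map _ _ (fun x => [:: _; _]) _ (fun x => erefl _)).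
Qed.

Lemma labelling_mark (Y : Type) (op : Y -> Y -> Y) e e' p c :
  c e = c e' ->
  labelling op (mark_segment e e' p) c <-> labelling op p c.
Proof.
move=> ee'; pose r u := if u == e then e' else u.
have rE u : c (r u) = c u by rewrite /r; case: eqP => // ->.
have okE x : crossing_ok op c (Crossing (positive x) (r (overpass x).1, (overpass x).2)
    (r (underpass x).1, (underpass x).2)) <-> crossing_ok op c x.
  by rewrite /crossing_ok /left_under /right_under /=; case: (positive x); rewrite !rE.
split=> -[cr mk]; split.
- by move=> x xp; apply/okE/cr/mapP; exists x.
- move=> x xp; rewrite -rE; apply: (mk (r x.1, x.2)).
  by rewrite inE; apply/orP; right; apply/mapP; exists x.
- by move=> _ /mapP[x xp ->]; apply/okE/cr.
- by move=> m; rewrite inE => /predU1P[->//|/mapP[x xp ->]] /=; rewrite -/(r _) rE mk.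
Qed.

(** The mark forces both halves of [e] to share a label, so the segments of [p] carry all the
    information in a labelling of [q]. *)
Lemma mark_transfer p q e e' :
    closed_labels p -> closed_labels q -> e \in incoming p ->
    same_picture q (mark_segment e e' p) ->
  transfer p q [in incoming p] /\ transfer q p [in incoming p].
Proof.
move=> [ip op_ iop] [iq oq ioq] ep qE.
pose r u := if u == e then e' else u.
have iqE := perm_trans (perm_incoming qE) (perm_incoming_mark e e' p).
(* The name [e'] is new because no incoming segment of [q] is repeated. *)
have [e'e e'p] : e' != e /\ e' \notin incoming p.
  move: iq; rewrite (perm_uniq iqE) /= -/r => /andP[er ur].
  have re : r e = e' by rewrite /r eqxx.
  have e'e : e' != e by apply: contraNneq er => e'e; rewrite -{1}e'e -{1}re map_f.
  split=> //; apply/negP => e'p.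
  move: ur; rewrite (perm_uniq (perm_map r (perm_to_rem ep))) /= re => /andP[/negP[]].
  have re' : r e' = e' by rewrite /r (negPf e'e).
  by apply/mapP; exists e' => //; rewrite mem_rem_uniq // !inE e'e.
have e'o : e' \notin outgoing p by rewrite -iop.
split; split=> //.
- move=> Y op c opQ cp; exists [eta c with e' |-> c e].
    apply: labelling_same (same_pictureC qE) _; apply/labelling_mark => /=.
      by rewrite eqxx eq_sym (negPf e'e).
    apply: eq_labelling cp => u up /=; case: eqP up => // ->.
      by rewrite (negPf e'p).
    by rewrite (negPf e'o).
  by move=> u up /=; case: eqP up => // ->; rewrite ?inE (negPf e'p).
- move=> u up; rewrite (perm_mem iqE) inE; have [//|ue] := eqVneq u e.
  by apply/mapP; exists u; rewrite ?(negPf ue).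
- move=> Y op c opQ /(labelling_same qE) cq; exists c => //.
  have ee' : c e = c e' := cq.2 (e, e') (mem_head _ _).
  exact/(labelling_mark _ _ ee').
- move=> Y op c c' opQ /(labelling_same qE)[_ mk] /(labelling_same qE)[_ mk'] cc' u.
  have ee' : c e = c e' := mk (e, e') (mem_head _ _).
  have ee'' : c' e = c' e' := mk' (e, e') (mem_head _ _).
  rewrite (perm_mem iqE) inE => /predU1P[->|/mapP[v vp ->]]; first exact: cc'.
  by case: eqP => _; [rewrite -ee' -ee'' cc'|exact: cc'].
Qed.

Lemma uniq_union p q : closed_labels (picture_union p q) ->
  uniq (incoming p) /\ uniq (outgoing p).
Proof.
move=> [+ + _]; rewrite (perm_uniq (perm_incoming_union _ _)).
rewrite (perm_uniq (perm_outgoing_union _ _)) cat_uniq => /andP[-> _].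
by rewrite cat_uniq => /andP[-> _].
Qed.

Lemma move_transfer p q : closed_labels p -> closed_labels q -> move p q ->
  exists K : pred E, transfer p q K /\ transfer q p K.
Proof.
move=> cp cq [pq|e e' ep qE|l l' r ll' pE qE].
- exists [in incoming p]; split; first exact: same_transfer.
  have := same_transfer (same_pictureC pq); congr transfer; apply/funext => u /=.
  by rewrite (perm_mem (perm_incoming pq)).
- by exists [in incoming p]; exact: mark_transfer qE.
have [il ol] := uniq_union (closed_labels_same pE cp).
have [il' ol'] := uniq_union (closed_labels_same qE cq).
have [n [n' [T T']]] := reidemeister_transfer ll' il ol il' ol'.
exists [pred u | [&& u \in incoming p, u \in incoming q, u \notin n & u \notin n']].
split; first exact: local_transfer_union pE qE T (inner_incoming T') (inner_outgoing T').
(* The tying predicate is symmetric in the two sides, up to the order of its conjuncts. *)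
have := local_transfer_union cq cp qE pE T' (inner_incoming T) (inner_outgoing T).
congr transfer; apply/funext => u /=.
by rewrite andbCA [(u \notin n') && _]andbC.
Qed.

End Moves.

(** * Diagrams *)

Lemma trivial_quandle (Y : Type) : is_quandle (fun x _ : Y => x).
Proof. by split=> //; exists (fun x _ => x). Qed.

Lemma incoming_relabel (E F : eqType) (i : E -> F) (p : picture E) :
  incoming (relabel i p) = map i (incoming p).
Proof.
rewrite /incoming /relabel /= map_cat map_flatten -!map_comp /unzip1 -map_comp.
by congr (flatten _ ++ _).
Qed.

Lemma outgoing_relabel (E F : eqType) (i : E -> F) (p : picture E) :
  outgoing (relabel i p) = map i (outgoing p).
Proof.
rewrite /outgoing /relabel /= map_cat map_flatten -!map_comp /unzip2 -map_comp.
by congr (flatten _ ++ _).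
Qed.

Lemma mem_incoming_diagram (D : diagram) (e : segment D) : e \in incoming D.
Proof. by have /andP[/perm_mem -> _] := diagram_closed D; rewrite mem_enum. Qed.

Lemma closed_labels_relabel (D : diagram) (i : segment D -> nat) :
  injective i -> closed_labels (relabel i D).
Proof.
move=> i_inj; have /andP[ip op_] := diagram_closed D.
rewrite /closed_labels incoming_relabel outgoing_relabel !(map_inj_uniq i_inj).
rewrite (perm_uniq ip) (perm_uniq op_) enum_uniq.
by split=> // u; apply: perm_mem; rewrite perm_map // (perm_trans ip) // perm_sym.
Qed.

Definition tied (E F Y : Type) (K : E -> F -> Prop) (c : E -> Y) (d : F -> Y) : Prop :=
  forall e f, K e f -> c e = d f.

(** If the converse relation is a transfer as well, being tied is a bijection between the labellings
    of the two diagrams. *)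
Record labelling_transfer (D D' : diagram) (K : segment D -> segment D' -> Prop) : Prop :=
  LabellingTransfer {
    tied_exists : forall (Y : Type) (op : Y -> Y -> Y) c,
      is_quandle op -> labelling op D c -> exists2 c', labelling op D' c' & tied K c c';
    tied_unique : forall (Y : Type) (op : Y -> Y -> Y) c1 c2 c',
      is_quandle op -> labelling op D c1 -> labelling op D c2 ->
      tied K c1 c' -> tied K c2 c' -> c1 = c2 }.

(** Carries a labelling of segments over to names in [nat]; [y] is a default off the image of [k],
    so an inhabitant of [Y] is required. *)
Definition extend (F : finType) (k : F -> nat) (Y : Type) (y : Y) (c : F -> Y) (n : nat) : Y :=
  if [pick e | k e == n] is Some e then c e else y.

Lemma extendE (F : finType) (k : F -> nat) (Y : Type) (y : Y) (c : F -> Y) e :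
  injective k -> extend k y c (k e) = c e.
Proof.
move=> k_inj; rewrite /extend.
by case: pickP => [e' /eqP/k_inj->//|/(_ e)]; rewrite eqxx.
Qed.

Lemma labelling_extend (D : diagram) (k : segment D -> nat) (Y : Type)
    (op : Y -> Y -> Y) (y : Y) (c : segment D -> Y) :
  injective k -> labelling op D c -> labelling op (relabel k D) (extend k y c).
Proof.
move=> k_inj cD; apply/labelling_relabel; congr labelling: cD.
by apply/funext => e; rewrite /= extendE.
Qed.

Lemma transfer_diagram (D D' : diagram) (i : segment D -> nat) (j : segment D' -> nat) K :
    injective i -> injective j ->
    transfer (relabel i D) (relabel j D') K -> transfer (relabel j D') (relabel i D) K ->
  labelling_transfer (fun e e' => i e = j e' /\ i e \in K).
Proof.
move=> i_inj j_inj T T'.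
have tieD n : n \in K -> exists e e', n = i e /\ i e = j e'.
  move=> nK; have := tie_incoming T nK; have := tie_incoming T' nK.
  by rewrite !incoming_relabel => /mapP[e' _ ->] /mapP[e _ je']; exists e, e'.
split=> [Y op c opQ cD|Y op c1 c2 c' opQ c1D c2D c1c' c2c']; last first.
  apply/funext => e.
  have agree : {in K, extend i (c1 e) c1 =1 extend i (c1 e) c2}.
    move=> n nK; have [e1 [e1' [nE e1E]]] := tieD n nK.
    rewrite nE in nK *; rewrite !extendE //.
    by rewrite (c1c' _ e1') ?(c2c' _ e1').
  rewrite -(extendE (c1 e) c1 e i_inj) -(extendE (c1 e) c2 e i_inj).
  apply: (determined T opQ _ _ agree); try exact: labelling_extend.
  by rewrite incoming_relabel map_f // mem_incoming_diagram.
have [[y _]|noY] := pselect (exists y : Y, True).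
  have [d dD dc] := extension T opQ (labelling_extend y i_inj cD).
  exists (d \o j); first exact/labelling_relabel.
  move=> e e' [ee' eK]; by rewrite /= -ee' dc // extendE.
(* [Y] may be empty.  Then [D] has no segment, and neither has [D']: otherwise its
   two constant labellings by the trivial quandle on bool would correspond to the
   same labelling of [D]. *)
have D'0 : segment D' -> False.
  move=> e'; have bD (b : bool) : labelling (fun x _ : bool => x) (relabel j D') (fun=> b).
    by split.
  suff: true = false by [].
  apply: (determined T' (trivial_quandle bool) (bD true) (bD false) _ (x := j e')).
    by move=> n /tieD[e]; case: noY; exists (c e).
  by rewrite incoming_relabel map_f // mem_incoming_diagram.
exists (fun e' => False_rect Y (D'0 e')); last by move=> e e'; case: (D'0 e').
by split=> [x|m] _; [case: (D'0 (overpass x).1)|case: (D'0 m.1)].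
Qed.

Lemma move_labelling_transfer (D D' : diagram) : diagram_move D D' ->
  exists K, labelling_transfer (D := D) (D' := D') K
    /\ labelling_transfer (D := D') (D' := D) (fun e' e => K e e').
Proof.
move=> [i [j [i_inj j_inj]]].
move=> /(move_transfer (closed_labels_relabel i_inj) (closed_labels_relabel j_inj)).
move=> [K [T T']]; exists (fun e e' => i e = j e' /\ i e \in K).
split; first exact: transfer_diagram.
have := transfer_diagram j_inj i_inj T' T; congr labelling_transfer.
by apply/funext => e'; apply/funext => e; apply/propext; split=> -[-> ->].
Qed.

(** * Arcs, colorings and beads *)

Section Arcs.
Variable D : diagram.

Lemma arc_of_continues (e e' : segment D) : continues e e' -> arc_of e = arc_of e'.
Proof.
move=> ee'; apply/val_inj/setP => u; rewrite !inE; apply: same_connect.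
  by apply: sym_connect_sym => v w; rewrite /= orbC.
by apply: connect1; rewrite /= ee'.
Qed.

Lemma labelling_arc_of (Y : Type) (op : Y -> Y -> Y) c (e e' : segment D) :
  labelling op D c -> arc_of e = arc_of e' -> c e = c e'.
Proof.
move=> [cr mk] /(congr1 val)/setP/(_ e'); rewrite !inE connect0 => /connectP[p + ->].
elim: p e => //= u p IH e /andP[eu /IH <-].
have step v w : continues v w -> c v = c w.
  by move=> /orP[/mk//|/mapP[x /cr[xE _] vw]]; move: xE; rewrite -vw.
by case/orP: eu => /step.
Qed.

Lemma arc_ofP (a : link_arc D) : exists e, arc_of e = a.
Proof. by have /imsetP[e _ eE] := valP a; exists e; apply: val_inj. Qed.

Definition arc_segment (a : link_arc D) : segment D := sval (cid (arc_ofP a)).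

Lemma arc_segmentK a : arc_of (arc_segment a) = a.
Proof. by rewrite /arc_segment; case: cid. Qed.

(** Labels coming from arcs are constant through overpasses and marks, so only the relation at the
    understrand remains. *)
Lemma labelling_arcs (Y : Type) (op : Y -> Y -> Y) (C : link_arc D -> Y) :
  labelling op D (C \o @arc_of D) <-> {in crossings D, forall x,
    C (arc_of (left_under x)) = op (C (arc_of (right_under x))) (C (arc_of (overpass x).1))}.
Proof.
split=> [[cr _] x /cr[]//|cr]; split=> [x xD|m mD] /=.
  split; last exact: cr.
  rewrite /= (@arc_of_continues (overpass x).1 (overpass x).2) //.
  by rewrite /continues /= -surjective_pairing map_f ?orbT.
by rewrite (@arc_of_continues m.1 m.2) // /continues /= -surjective_pairing mD.
Qed.

Lemma labelling_arc_segment (Y : Type) (op : Y -> Y -> Y) c :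
  labelling op D c -> (c \o arc_segment) \o @arc_of D = c.
Proof.
move=> cD; apply/funext => e; apply: (labelling_arc_of cD).
by rewrite arc_segmentK.
Qed.

End Arcs.

Lemma finQuandle_quandle (X : finQuandle) : is_quandle (@qop X).
Proof.
split; [exact: qop_id| |exact: qop_dist].
have H y : exists g, cancel (fun x : X => qop x y) g /\ cancel g (fun x : X => qop x y).
  by have [g] := qop_bij (f := X) y; exists g.
by have [g gK] := choice H; exists (fun x y => g y x).
Qed.

Section Colorings.
Variables (X : finQuandle) (D : diagram).

Lemma labelling_coloring (C : coloring X D) :
  labelling (@qop X) D (val C \o @arc_of D).
Proof. by apply/labelling_arcs => x /(allP (valP C))/eqP. Qed.

Lemma coloring_labelling c : labelling (@qop X) D c ->
  exists C : coloring X D, val C \o @arc_of D = c.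
Proof.
move=> cD; pose C := [ffun a => c (arc_segment a)].
have CE : C \o @arc_of D = c.
  by rewrite -[RHS](labelling_arc_segment cD); apply/funext => e; rewrite /= ffunE.
have CP : is_coloring C.
  by move: cD; rewrite -CE => /labelling_arcs H; apply/allP => x /H/eqP.
by exists (exist _ C CP).
Qed.

Lemma coloring_inj (C C' : coloring X D) :
  val C \o @arc_of D = val C' \o @arc_of D -> C = C'.
Proof.
move=> CC'; apply/val_inj/ffunP => a; rewrite -(arc_segmentK a).
exact: (congr1 (@^~ (arc_segment a)) CC').
Qed.

End Colorings.

(** * Beads as labellings by the module quandle *)

Section ModuleQuandle.
Variables (X : finQuandle) (R : comPzRingType) (t s : X -> X -> R).

Definition module_op (p q : X * R) : X * R :=
  (qop p.1 q.1, t p.1 q.1 * p.2 + s p.1 q.1 * q.2).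

(** [qmod_id] gives idempotence and [qmod_unit] invertibility; [qmod_tt], [qmod_ts] and [qmod_ss]
    match the coefficients of [a], [b] and [c] in distributivity. *)
Lemma module_quandle : quandle_module t s -> is_quandle module_op.
Proof.
move=> ts; split.
- by move=> [x a]; rewrite /module_op /= qop_id -mulrDl (qmod_id ts) mul1r.
- have [inv invK] := op_inv (finQuandle_quandle X).
  have /choice[u uK] : forall p : X * X, exists u, t p.1 p.2 * u = 1.
    by move=> p; exact: qmod_unit ts _ _.
  (* The second component solves [t * a + s * q.2 = p.2] for [a], with [u] the inverse of [t]. *)
  exists (fun p q => let x := inv p.1 q.1 in (x, u (x, q.1) * (p.2 - s x q.1 * q.2))).
  move=> [y b]; have [K1 K2] := invK y; split=> -[x a]; rewrite /module_op /=.
    rewrite K1 addrK; congr pair.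
    by rewrite mulrA [u _ * _]mulrC (uK (x, y)) mul1r.
  by rewrite K2 mulrA (uK (inv x y, y)) mul1r subrK.
- move=> [x a] [y b] [z c]; rewrite /module_op /= qop_dist; congr pair.
  rewrite mulrDr !mulrA (qmod_tt ts x y z) (qmod_ts ts x y z) (qmod_ss ts x y z).
  by rewrite !mulrDr !mulrDl !mulrA addrACA.
Qed.

Variable D : diagram.

Definition bead (v : 'cV[R]_#|link_arc D|) (e : segment D) : R :=
  v (enum_rank (arc_of e)) 0.

Lemma sum_indicator (T : finType) (S : pzRingType) (v : 'cV[S]_#|T|) (r : S) (a : T) :
  \sum_j r *+ (enum_val j == a) * v j 0 = r * v (enum_rank a) 0.
Proof.
rewrite (bigD1 (enum_rank a)) //= enum_rankK eqxx big1 ?addr0 // => j ja.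
case: eqP => [jE|]; last by rewrite mul0r.
by move: ja; rewrite -jE enum_valK eqxx.
Qed.

Lemma module_kernelP (C : coloring X D) v : module_kernel t s C v <->
  labelling module_op D (fun e => (val C (arc_of e), bead v e)).
Proof.
pose Cv a := (val C a, v (enum_rank a) 0).
(* A row of the product is the defect of the bead half of a crossing equation; the color half holds
   because [C] is a coloring. *)
have rowE i : (module_matrix t s C *m v) i 0 =
    let k := tnth (in_tuple (crossings D)) i in
    (module_op (Cv (arc_of (right_under k))) (Cv (arc_of (overpass k).1))).2
    - (Cv (arc_of (left_under k))).2.
  rewrite mxE; under eq_bigr do rewrite mxE mulrBl mulrDl.
  by rewrite sumrB big_split /= !sum_indicator mul1r.
rewrite -[X in _ <-> X]/(labelling module_op D (Cv \o @arc_of D)) labelling_arcs.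
split=> [v0 x xD|H].
  have xi : (index x (crossings D) < size (crossings D))%N by rewrite index_mem.
  have := rowE (Ordinal xi).
  rewrite v0 mxE /= (tnth_nth x) /= nth_index // => /esym/eqP; rewrite subr_eq0 => /eqP e2.
  rewrite /Cv [LHS]surjective_pairing [RHS]surjective_pairing /= e2; congr pair.
  exact/eqP/(allP (valP C)).
apply/matrixP => i j; rewrite [j]ord1 rowE mxE /=.
have /(congr1 snd) /= <- := H _ (mem_tnth i (in_tuple (crossings D))).
by rewrite subrr.
Qed.

End ModuleQuandle.

(** * Weights under linear correspondences *)

Section Weight.
Variables (R : comPzRingType) (V V' : lmodType R).

(** When the converse of [G] has the same property, [G] is the graph of a linear isomorphism between
    [N] and [N'], here given as subsets of modules. *)
Record linear_correspondence (N : set V) (N' : set V') (G : V -> V' -> Prop) : Prop :=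
  LinearCorrespondence {
    corr_linear : forall a u v u' v', G u u' -> G v v' -> G (a *: u + v) (a *: u' + v');
    corr_sub : forall u u', G u u' -> N u /\ N' u';
    corr_total : forall u, N u -> exists u', G u u';
    corr_inj : forall u v u', G u u' -> G v u' -> u = v }.
End Weight.

Lemma linear_correspondence_free_part (R : comPzRingType) (V V' : lmodType R)
    (N : set V) (N' : set V') G r :
    linear_correspondence N N' G -> linear_correspondence N' N (fun u' u => G u u') ->
  has_free_part N r -> has_free_part N' r.
Proof.
move=> GL GL' [T [f [f_inj fN]]].
have fN' w : N (f w) by rewrite -fN; exists w.
(* The parametrization of [N'] sends [w] to the partner of [f w]; it is linear because partners are
   unique. *)
have /choice[g gG] w : exists u', G (f w) u' := corr_total GL (fN' w).
have g_lin : linear g.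
  move=> a w1 w2; apply: (corr_inj GL' (gG _)); rewrite linearP.
  by apply: (corr_linear GL); apply: gG.
pose gL : {linear ('rV[R]_r * T)%type -> V'} :=
  HB.pack g (GRing.isLinear.Build _ _ _ _ _ g_lin).
exists T, gL; split.
  move=> w1 w2 g12; apply: f_inj; apply: (corr_inj GL (gG w1)).
  by rewrite [g w1]g12; exact: gG.
apply/seteqP; split=> [_ [w _ <-]|u' /(corr_total GL')[u Gu]].
  by case: (corr_sub GL (gG w)).
have [Nu _] := corr_sub GL Gu; move: Nu; rewrite -fN => -[w _ wu].
by exists w => //; apply: (corr_inj GL' (gG w)); rewrite wu.
Qed.

Lemma linear_correspondence_weight (R : comPzRingType) (V V' : lmodType R)
    (N : set V) (N' : set V') G :
    linear_correspondence N N' G -> linear_correspondence N' N (fun u' u => G u u') ->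
  module_weight N = module_weight N'.
Proof.
move=> GL GL'; rewrite /module_weight; case: pselect => finR /=.
  have NN' : (N #= N')%card.
    have /choice[g gG] u : exists u', N u -> G u u'.
      have [Nu|Nu] := pselect (N u); last by exists 0.
      by have [u' Gu] := corr_total GL Nu; exists u'.
    have -> : N' = (g @` N)%classic.
      apply/seteqP; split=> [u' /(corr_total GL')[u Gu]|_ [u Nu <-]].
        have [Nu _] := corr_sub GL Gu.
        by exists u => //; apply: (corr_inj GL' (gG _ Nu)).
      by case: (corr_sub GL (gG _ Nu)).
    rewrite card_eq_sym; apply: inj_card_eq => u v /set_mem Nu /set_mem Nv guv.
    by apply: (corr_inj GL (gG _ Nu)); rewrite guv; exact: gG.
  have [fN|fN] := pselect (finite_set N).
    by apply/(fcard_eq fN) => //; rewrite -(eq_finite_set NN').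
  (* [fset_set] is empty by default on infinite sets, and [N'] is infinite along with [N]. *)
  rewrite /fset_set; case: pselect => // _; case: pselect => // fN'.
  by case: fN; rewrite (eq_finite_set NN').
rewrite /free_rank.
have -> : has_free_part N = has_free_part N'; last by [].
apply/funext => r; apply/propext; split.
  exact: linear_correspondence_free_part GL GL'.
exact: linear_correspondence_free_part GL' GL.
Qed.

(** * Correspondence of colorings and of module kernels *)

Lemma tiedC (E F Y : Type) (K : E -> F -> Prop) (c : E -> Y) (d : F -> Y) :
  tied K c d <-> tied (fun f e => K e f) d c.
Proof. by split=> cd e f /cd. Qed.

Definition tied_colorings (X : finQuandle) (D D' : diagram)
    (K : segment D -> segment D' -> Prop) (C : coloring X D) (C' : coloring X D') : Prop :=
  tied K (val C \o @arc_of D) (val C' \o @arc_of D').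

Definition tied_beads (X : finQuandle) (R : comPzRingType) (t s : X -> X -> R)
    (D D' : diagram) (K : segment D -> segment D' -> Prop)
    (C : coloring X D) (C' : coloring X D')
    (v : 'cV[R]_#|link_arc D|) (v' : 'cV[R]_#|link_arc D'|) : Prop :=
  [/\ module_kernel t s C v, module_kernel t s C' v' & tied K (bead v) (bead v')].

Section Correspondence.
Variables (X : finQuandle) (D D' : diagram) (K : segment D -> segment D' -> Prop).
Hypothesis KT : labelling_transfer (D := D) (D' := D') K.

Lemma tied_coloring_exists (C : coloring X D) :
  exists C' : coloring X D', tied_colorings K C C'.
Proof.
have [c' /coloring_labelling[C' <-] CC'] :=
  tied_exists KT (finQuandle_quandle X) (labelling_coloring C).
by exists C'.
Qed.

Lemma tied_coloring_inj (C1 C2 : coloring X D) (C' : coloring X D') :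
  tied_colorings K C1 C' -> tied_colorings K C2 C' -> C1 = C2.
Proof.
move=> T1 T2; apply/coloring_inj.
exact: (tied_unique KT (finQuandle_quandle X) (labelling_coloring _)
  (labelling_coloring _) T1 T2).
Qed.

Lemma tied_apply_endo (f : endo X) (C : coloring X D) (C' : coloring X D') :
  tied_colorings K C C' -> tied_colorings K (apply_endo f C) (apply_endo f C').
Proof. by move=> CC' e e' /CC' /= ee'; rewrite /= !ffunE ee'. Qed.

(** The transfer is applied to the module quandle over a fixed pair of tied colorings; linearity
    holds because being tied is a family of equalities between beads. *)
Lemma tied_kernel (R : comPzRingType) (t s : X -> X -> R)
    (C : coloring X D) (C' : coloring X D') :
    labelling_transfer (D := D') (D' := D) (fun e' e => K e e') ->
    quandle_module t s -> tied_colorings K C C' ->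
  linear_correspondence (module_kernel t s C) (module_kernel t s C')
    (tied_beads t s K C C').
Proof.
move=> KT' ts CC'; have mQ := module_quandle ts; split.
- move=> a u v u' v' [ku ku' uu'] [kv kv' vv']; split.
  + by rewrite /module_kernel /= mulmxDr -scalemxAr ku kv scaler0 addr0.
  + by rewrite /module_kernel /= mulmxDr -scalemxAr ku' kv' scaler0 addr0.
  + by move=> e e' ee'; rewrite /bead !mxE; congr (a * _ + _); [apply: uu'|apply: vv'].
- by move=> u u' [].
- move=> u /[dup] ku /module_kernelP/(tied_exists KT mQ)[c' cD' cc'].
  (* The transferred labelling brings its own coloring of [D']. Projection to [X] is a quandle
     morphism, so that coloring is tied to [C], and uniqueness identifies it with [C']. *)
  have c'1 : fst \o c' = val C' \o @arc_of D'.
    apply: (tied_unique KT' (finQuandle_quandle X)); last 2 first.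
    + by apply/tiedC => e e' /cc' ee'; rewrite /= -ee'.
    + exact/tiedC.
    + by case: cD' => cr mk; split=> [x /cr[] xE /(congr1 fst)|m /mk /(congr1 fst)] //;
        split=> //=; rewrite xE.
    exact: labelling_coloring.
  pose u' : 'cV[R]_#|link_arc D'| := \col_i (c' (arc_segment (enum_val i))).2.
  have c'2 e' : bead u' e' = (c' e').2.
    rewrite /bead mxE enum_rankK.
    by rewrite (labelling_arc_of cD' (arc_segmentK (arc_of e'))).
  exists u'; split=> //; last by move=> e e' /cc'; rewrite c'2 => <-.
  apply/module_kernelP; congr labelling: cD'; apply/funext => e'.
  rewrite c'2 [LHS]surjective_pairing; congr pair.
  exact: (congr1 (@^~ e') c'1).
- move=> u v u' [/module_kernelP ku _ uu'] [/module_kernelP kv _ vu'].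
  have uv : (fun e => (val C (arc_of e), bead u e)) = (fun e => (val C (arc_of e), bead v e)).
    apply: (tied_unique KT mQ ku kv (c' := fun e' => (val C' (arc_of e'), bead u' e'))).
      by move=> e e' ee'; congr pair; [exact: CC'|exact: uu'].
    by move=> e e' ee'; congr pair; [exact: CC'|exact: vu'].
  apply/matrixP => i j; rewrite [j]ord1.
  have /(congr1 snd) := congr1 (@^~ (arc_segment (enum_val i))) uv.
  by rewrite /= /bead arc_segmentK enum_valK.
Qed.

End Correspondence.

Lemma tied_weight (X : finQuandle) (R : comPzRingType) (t s : X -> X -> R)
    (D D' : diagram) (K : segment D -> segment D' -> Prop)
    (C : coloring X D) (C' : coloring X D') :
    labelling_transfer (D := D) (D' := D') K ->
    labelling_transfer (D := D') (D' := D) (fun e' e => K e e') ->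
    quandle_module t s -> tied_colorings K C C' ->
  module_weight (module_kernel t s C) = module_weight (module_kernel t s C').
Proof.
move=> KT KT' ts CC'; apply: linear_correspondence_weight (tied_kernel KT KT' ts CC') _.
have := tied_kernel KT' KT ts ((tiedC _ _ _).1 CC').
congr linear_correspondence; apply/funext => v'; apply/funext => v; apply/propext.
by split=> -[kv kv' vv']; split=> //; apply/tiedC.
Qed.

(** * Invariance of the polynomial *)

Lemma move_polynomial (X : finQuandle) (S : {set endo X}) (R : comPzRingType)
    (t s : X -> X -> R) (D D' : diagram) :
  quandle_module t s -> diagram_move D D' ->
  module_quiver_polynomial S t s D = module_quiver_polynomial S t s D'.
Proof.
move=> ts /move_labelling_transfer[K [KT KT']].
have /choice[F FT] := @tied_coloring_exists X _ _ _ KT.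
have /choice[G GT] := @tied_coloring_exists X _ _ _ KT'.
(* An edge is a coloring together with an endomorphism, so the bijection [F] of vertices induces one
   of edges. *)
have F_bij : bijective (fun e : coloring X D * {f : endo X | f \in S} => (F e.1, e.2)).
  exists (fun e => (G e.1, e.2)) => -[C f]; congr pair.
    by apply: (tied_coloring_inj KT) (FT C); apply/tiedC/GT.
  by apply: (tied_coloring_inj KT') (GT C); apply/tiedC/FT.
rewrite /module_quiver_polynomial /quiver_polynomial /= [RHS](reindex _ (onW_bij _ F_bij)) /=.
apply: eq_bigr => -[C [f fS]] _ /=.
(* Applying [f] to both members of a tied pair gives a tied pair, so uniqueness makes [F] commute
   with [f] and preserve targets. *)
have -> : apply_endo f (F C) = F (apply_endo f C).
  apply: (tied_coloring_inj KT' (C' := apply_endo f C)); last by apply/tiedC/FT.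
  by apply/tiedC/tied_apply_endo/FT.
by rewrite !(tied_weight KT KT' ts (FT _)).
Qed.

Theorem corollary4 (X : finQuandle) (S : {set endo X}) (R : comPzRingType)
    (t s : X -> X -> R) (ts : quandle_module t s)
    (D D' : diagram) (DD' : same_link D D') :
  module_quiver_polynomial S t s D = module_quiver_polynomial S t s D'.
Proof.
elim: DD' => [D1 D2 D12|//|D1 D2 _ ->//|D1 D2 D3 _ -> _ ->//].
exact: move_polynomial.
Qed.
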